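(* For all integers $a\ge1$, $q\ge0$ and $m\ge1$, $$L_m^{(a)}(q)=\mathbf 1_N^T\,(A_q^{(a)})^{m-1}\,\mathbf 1_N=\mu_q^{(a)}\,(C_q^{(a)})^{m-1}\,\mathbf 1_{q+1}.$$ Equivalently, for every $n\ge0$, $$\mathbf 1_N^T\,(A_q^{(a)})^{n}\,\mathbf 1_N=\mu_q^{(a)}\,(C_q^{(a)})^{n}\,\mathbf 1_{q+1}.$$ Therefore, as formal power series in $y$, $$\mathcal F_q^{(a)}(y):=\sum_{m\ge1}L_m^{(a)}(q)\,y^{m-1}=\mu_q^{(a)}\,(I-yC_q^{(a)})^{-1}\,\mathbf 1_{q+1}.$$
   Context: For integers $a,m\ge1$ let $x=(x_{i,j})_{1\le i\le m,\,1\le j\le a}\in\mathbb R^{am}$ and $R_i=x_{i,1}+\cdots+x_{i,a}$. The path block polytope is $\mathcal P_m^{(a)}=\{x\in\mathbb R_{\ge0}^{am}: R_i+R_{i+1}\le1,\ 1\le i\le m-1\}$ for $m\ge2$, and $\mathcal P_1^{(a)}=\{x\in\mathbb R_{\ge0}^{a}:R_1\le1\}$ for $m=1$. For integers $q\ge0$, $L_m^{(a)}(q)=\#(q\mathcal P_m^{(a)}\cap\mathbb Z^{am})$. Let $S_q^{(a)}=\{u\in\mathbb Z_{\ge0}^a: |u|:=u_1+\cdots+u_a\le q\}$ and $N=|S_q^{(a)}|=\binom{q+a}{a}$. The matrix $A_q^{(a)}$ is the $N\times N$ matrix with rows and columns indexed by $S_q^{(a)}$ and entries $A_q^{(a)}(u,v)=1$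 if $|u|+|v|\le q$ and $0$ otherwise. Put $w_s^{(a)}=\binom{s+a-1}{a-1}$, let $\mu_q^{(a)}=(w_0^{(a)},\ldots,w_q^{(a)})$ (a row vector), and let $C_q^{(a)}$ be the $(q+1)\times(q+1)$ matrix indexed by $0\le r,s\le q$ with $(C_q^{(a)})_{r,s}=w_s^{(a)}$ if $r+s\le q$ and $0$ otherwise. $\mathbf 1_k$ denotes the all-one column vector of size $k$. *)

(* Defs.v *)
From HB Require Import structures.
From mathcomp Require Import all_boot all_order all_algebra.
From mathcomp Require Import finmap.
From mathcomp Require Import boolp classical_sets cardinality reals.

Set Implicit Arguments.
Unset Strict Implicit.
Unset Printing Implicit Defensive.

Import Order.TTheory GRing.Theory Num.Theory.
Local Open Scope ring_scope.

Record fps (R : Type) := Fps { fps_coef : nat -> R }.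

Lemma fpsP (R : Type) (f g : fps R) : fps_coef f =1 fps_coef g <-> f = g.
Proof. by split=> [|-> //]; case: f g => f [g] /= /funext ->. Qed.

HB.instance Definition _ (R : Type) := gen_eqMixin (fps R).
HB.instance Definition _ (R : Type) := gen_choiceMixin (fps R).

Section FpsRing.
Variable R : comNzRingType.
Implicit Types f g h : fps R.

Definition fps_opp f := Fps (fun n => - fps_coef f n).
Definition fps_add f g := Fps (fun n => fps_coef f n + fps_coef g n).
Definition fps_mul f g :=
  Fps (fun n => \sum_(i < n.+1) fps_coef f i * fps_coef g (n - i)).
Definition fpsC (c : R) := Fps (fun n => if n == 0%N then c else 0).
Definition fpsX : fps R := Fps (fun n => (n == 1%N)%:R).

Fact fps_addA : associative fps_add.
Proof. by move=> f g h; apply/fpsP => n /=; rewrite addrA. Qed.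
Fact fps_addC : commutative fps_add.
Proof. by move=> f g; apply/fpsP => n /=; rewrite addrC. Qed.
Fact fps_add0 : left_id (fpsC 0) fps_add.
Proof. by move=> f; apply/fpsP => n /=; rewrite if_same add0r. Qed.
Fact fps_addN : left_inverse (fpsC 0) fps_opp fps_add.
Proof. by move=> f; apply/fpsP => n /=; rewrite if_same addNr. Qed.

HB.instance Definition _ := GRing.isZmodule.Build (fps R)
  fps_addA fps_addC fps_add0 fps_addN.

Fact fps_mulC : commutative fps_mul.
Proof.
move=> f g; apply/fpsP => n /=; rewrite (reindex_inj rev_ord_inj) /=.
by apply: eq_bigr => i _; rewrite subSS subKn ?leq_ord // mulrC.
Qed.

Fact fps_mulA : associative fps_mul.
Proof.
have revE f g n : fps_coef (fps_mul f g) n =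
    \sum_(i < n.+1) fps_coef f (n - i)%N * fps_coef g i.
  by rewrite fps_mulC /=; apply: eq_bigr => i _; rewrite mulrC.
have mulE f g n : fps_coef (fps_mul f g) n =
    \sum_(i < n.+1) fps_coef f i * fps_coef g (n - i)%N by [].
move=> f g h; apply/fpsP => i; rewrite mulE revE.
pose coef3 j k := fps_coef f j * (fps_coef g (i - j - k) * fps_coef h k).
transitivity (\sum_(j < i.+1) \sum_(k < i.+1 | (k <= i - j)%N) coef3 j k).
  apply: eq_bigr => j _; rewrite revE big_distrr /=.
  by rewrite (big_ord_narrow_leq (leq_subr _ _)).
rewrite (exchange_big_dep predT) //=; apply: eq_bigr => k _.
transitivity (\sum_(j < i.+1 | (j <= i - k)%N) coef3 j k).
  apply: eq_bigl => j; rewrite -ltnS -(ltnS j) -!subSn ?leq_ord //.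
  by rewrite -subn_gt0 -(subn_gt0 j) -!subnDA addnC.
rewrite (big_ord_narrow_leq (leq_subr _ _)) big_distrl /=.
by apply: eq_bigr => j _; rewrite /coef3 -!subnDA addnC mulrA.
Qed.

Fact fps_mul1 : left_id (fpsC 1) fps_mul.
Proof.
move=> f; apply/fpsP => n /=; rewrite big_ord_recl /= mul1r subn0.
by rewrite big1 ?addr0 // => i _; rewrite mul0r.
Qed.

Fact fps_mulDl : left_distributive fps_mul fps_add.
Proof.
move=> f g h; apply/fpsP => n /=; rewrite -big_split /=.
by apply: eq_bigr => i _; rewrite mulrDl.
Qed.

Fact fps_oner_neq0 : fpsC 1 != 0.
Proof. by apply/eqP => /fpsP/(_ 0%N) /= /eqP; rewrite oner_eq0. Qed.

HB.instance Definition _ := GRing.Zmodule_isComNzRing.Build (fps R)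
  fps_mulA fps_mulC fps_mul1 fps_mulDl fps_oner_neq0.

Definition fps_unit : pred (fps R) := fun f => `[< exists g, g * f = 1 >].
Definition fps_inv f : fps R :=
  if pselect (exists g, g * f = 1) is left fU then projT1 (cid fU) else f.

Fact fps_mulVr : {in fps_unit, left_inverse 1 fps_inv *%R}.
Proof.
move=> f /asboolP fU; rewrite /fps_inv; case: pselect => // fU'.
exact: projT2 (cid fU').
Qed.
Fact fps_unitP f g : g * f = 1 -> fps_unit f.
Proof. by move=> gf1; apply/asboolP; exists g. Qed.
Fact fps_inv_out : {in [predC fps_unit], fps_inv =1 id}.
Proof.
by move=> f /asboolPn fN; rewrite /fps_inv; case: pselect.
Qed.

HB.instance Definition _ := GRing.ComNzRing_hasMulInverse.Build (fps R)
  fps_mulVr fps_unitP fps_inv_out.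

End FpsRing.

Arguments fpsX {R}.

Section Polytope.
Variable R : realType.
Local Open Scope classical_set_scope.

Definition row_total (m a : nat) (x : 'M[R]_(m, a)) (i : 'I_m) : R :=
  \sum_(j < a) x i j.

(* Points of R^(am) are m x a matrices. *)
Definition path_block_polytope (m a : nat) : set 'M[R]_(m, a) :=
  [set x : 'M[R]_(m, a) | (forall i j, 0 <= x i j) /\
    if m == 1%N then forall i : 'I_m, row_total x i <= 1
    else forall i i' : 'I_m, i' = i.+1 :> nat ->
           row_total x i + row_total x i' <= 1].
Arguments path_block_polytope : clear implicits.

Definition lattice (m a : nat) : set 'M[R]_(m, a) :=
  [set x : 'M[R]_(m, a) | forall i j, x i j \is a Num.int].
Arguments lattice : clear implicits.

Definition dilate (m a : nat) (c : R) (P : set 'M[R]_(m, a)) :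
  set 'M[R]_(m, a) := [set c *: x | x in P].

(* [fset_set] sends an infinite set to the empty one; the set counted here is
   finite as soon as [0 < m], since every coordinate then lies in [0, q]. *)
Definition lattice_count (a m q : nat) : nat :=
  #|` fset_set (dilate q%:R (path_block_polytope m a) `&` lattice m a)|.

End Polytope.

Definition weight (a q : nat) (u : a.-tuple 'I_q.+1) : nat := \sum_(i <- u) i.

(* Each entry of a vector of weight at most q is itself at most q. *)
Definition states (a q : nat) : {set a.-tuple 'I_q.+1} :=
  [set u | (weight u <= q)%N].

Lemma card_states (a q : nat) : #|states a q| = 'C(q + a, a).
Proof. by rewrite addnC -card_partial_ord_partitions; apply: eq_card. Qed.

Definition Amx (a q : nat) : 'M[int]_#|states a q| :=
  \matrix_(u, v) ((weight (enum_val u) + weight (enum_val v) <= q)%N)%:R.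

(* The number of vectors of weight s in a coordinates, for 0 < a. *)
Definition wt (a s : nat) : nat := 'C(s + a - 1, a - 1).

Definition mu (a q : nat) : 'rV[int]_q.+1 := \row_(s < q.+1) (wt a s)%:R.

Definition Cmx (a q : nat) : 'M[int]_q.+1 :=
  \matrix_(r, s) if (r + s <= q)%N then (wt a s)%:R else 0.

Definition ones (T : pzRingType) (k : nat) : 'cV[T]_k := const_mx 1.
Arguments ones {T} k.

Definition scalar_of (T : Type) (M : 'M[T]_1) : T := M ord0 ord0.

(* Its coefficient of degree n is the count for a path of length n + 1. *)
Definition count_series (R : realType) (a q : nat) : fps int :=
  Fps (fun n => (lattice_count R a n.+1 q)%:Z).

Definition fps_mx (m n : nat) (M : 'M[int]_(m, n)) : 'M[fps int]_(m, n) :=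
  map_mx (@fpsC int) M.

(* Main.v *)
Require Import Defs.
From mathcomp Require Import all_boot all_order all_algebra reals.
From mathcomp Require Import finmap boolp classical_sets cardinality.

Set Implicit Arguments.
Unset Strict Implicit.
Unset Printing Implicit Defensive.

Import Order.TTheory GRing.Theory Num.Theory.
Local Open Scope ring_scope.

(* Reading a lattice point of the dilated polytope row by row gives a walk on
   the vectors of weight at most q, two vectors being adjacent when their
   weights add up to at most q; the walks are counted by the powers of the
   adjacency matrix A. The number of walks from a vector only depends on its
   weight, so grouping the wt a s vectors of weight s replaces A by C. The
   generating series is then the geometric series of yC. *)

(** * Walks for a relation on a finite type *)

Section Walks.
Variables (T : finType) (e : rel T).

(** The recursion is on the first step, to match [A ^+ n.+1 = A * A ^+ n] applied to the all-one
    vector. *)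
Fixpoint walks (n : nat) (u : T) : nat :=
  if n is n'.+1 then (\sum_(v | e u v) walks n' v)%N else 1%N.

(** Consing is a bijection from pairs (head, tail) onto nonempty tuples. *)
Lemma card_tuple_cons (n : nat) (P : pred (n.+1.-tuple T)) :
  #|P| = (\sum_(u : T) #|[pred t : n.-tuple T | P [tuple of u :: t]]|)%N.
Proof.
pose cons_pair (p : T * n.-tuple T) : n.+1.-tuple T := [tuple of p.1 :: p.2].
have cons_bij : bijective cons_pair.
  exists (fun t => (thead t, [tuple of behead t])) => [[u t]|t].
    by congr (_, _); apply: val_inj.
  by rewrite /cons_pair /= -tuple_eta.
rewrite -sum1_card (reindex cons_pair) /=; last exact: onW_bij.
under [RHS]eq_bigr => u _ do rewrite -sum1_card.
by rewrite pair_big_dep.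
Qed.

Lemma card_path (n : nat) (u : T) :
  #|[pred t : n.-tuple T | path e u t]| = walks n u.
Proof.
elim: n u => [|n IHn] u /=.
  by rewrite (eq_card (B := predT)) ?card_tuple ?expn0 // => t; rewrite (tuple0 t).
rewrite card_tuple_cons [RHS]big_mkcond; apply: eq_bigr => v _.
rewrite -IHn; case: ifP => euv; last first.
  by apply: eq_card0 => t; rewrite !inE /= euv.
by apply: eq_card => t; rewrite !inE /= euv.
Qed.

End Walks.

(** * Admissible sequences of states and lumping by weight *)

Definition fits (a q : nat) : rel (a.-tuple 'I_q.+1) :=
  fun u v => (weight u + weight v <= q)%N.

(* For [0 < n] the bound on the head already follows from [sorted]. *)
Definition admissible (a q n : nat) : pred (n.+1.-tuple (a.-tuple 'I_q.+1)) :=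
  fun t => (weight (thead t) <= q)%N && sorted (@fits a q) t.

Lemma card_admissible (a q n : nat) :
  #|@admissible a q n| = (\sum_(u in states a q) walks (@fits a q) n u)%N.
Proof.
rewrite card_tuple_cons [RHS]big_mkcond; apply: eq_bigr => u _.
rewrite inE -card_path.
rewrite -[LHS]/#|[pred t : n.-tuple _ | (weight u <= q)%N && path (@fits a q) u t]|.
by case: ifP => _ //; apply: eq_card0.
Qed.

Lemma weightE (a q : nat) (u : a.-tuple 'I_q.+1) :
  weight u = (\sum_(j < a) tnth u j)%N.
Proof. by rewrite /weight big_tuple. Qed.

(** The entries of a vector of weight [s] are at most [s], so widening ['I_s.+1] to ['I_q.+1]
    reaches all such vectors, and [card_ord_partitions] counts those with entries in ['I_s.+1]. *)
Lemma card_weight (a q s : nat) : (0 < a)%N -> (s <= q)%N ->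
  #|[pred u : a.-tuple 'I_q.+1 | weight u == s]| = wt a s.
Proof.
case: a => // a _ sq; rewrite /wt addnS !subn1 /= addnC -card_ord_partitions.
pose widen := map_tuple (widen_ord (n := s.+1) (m := q.+1) sq) : a.+1.-tuple _ -> _.
have widen_inj : injective widen.
  move=> t1 t2 /(congr1 val) /= /inj_map tt; apply/val_inj/tt.
  by move=> i j /(congr1 val) /= ij; apply: val_inj.
have weight_widen t : weight (widen t) = (\sum_(i <- t) i)%N.
  by rewrite /weight /= big_map.
rewrite -(card_imset _ widen_inj); apply: eq_card => u.
rewrite inE; apply/eqP/imsetP => [wu|[t]]; last first.
  by rewrite inE -weight_widen => /eqP <- ->.
have u_le j : (tnth u j <= s)%N.
  by rewrite -wu weightE (bigD1 j) //= leq_addr.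
have uE : u = widen [tuple inord (tnth u j) | j < a.+1].
  apply: eq_from_tnth => j; apply: val_inj.
  by rewrite tnth_map /= tnth_mktuple inordK // ltnS.
exists [tuple inord (tnth u j) | j < a.+1] => //; rewrite inE -weight_widen -uE; exact/eqP.
Qed.

(* Lumps the states of equal weight together, which collapses A to C. *)
Lemma sum_weight (a q k : nat) (F : nat -> nat) : (0 < a)%N ->
  (\sum_(u : a.-tuple 'I_q.+1 | (k + weight u <= q)%N) F (weight u) =
   \sum_(s < q.+1 | (k + s <= q)%N) wt a s * F s)%N.
Proof.
move=> a_gt0.
(* The constraint forces [weight u <= q], so [inord] keeps the weight intact and the fibres are the
   classes of equal weight. *)
rewrite (partition_big (fun u => inord (weight u) : 'I_q.+1)
           (fun s : 'I_q.+1 => (k + s <= q)%N)) /=; last first.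
  move=> u ku; rewrite inordK // ltnS.
  exact: leq_trans (leq_addl _ _) ku.
apply: eq_bigr => s ks.
rewrite -(card_weight a_gt0 (ltn_ord s : s <= q)%N) -sum_nat_const.
apply: eq_big => [u|u /andP[ku /eqP <-]].
  rewrite inE; apply/andP/eqP => [[ku /eqP <-]|wu]; last first.
    by rewrite wu ks; split=> //; apply/eqP/val_inj; rewrite /= inordK.
  by rewrite inordK // ltnS (leq_trans (leq_addl _ _) ku).
by rewrite inordK // ltnS (leq_trans (leq_addl _ _) ku).
Qed.

Fixpoint weight_walks (a q n r : nat) : nat :=
  if n is n'.+1 then
    (\sum_(s < q.+1 | (r + s <= q)%N) wt a s * weight_walks a q n' s)%N
  else 1%N.

Lemma walks_weight (a q n : nat) (u : a.-tuple 'I_q.+1) : (0 < a)%N ->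
  walks (@fits a q) n u = weight_walks a q n (weight u).
Proof.
move=> a_gt0; elim: n u => //= n IHn u.
rewrite -(sum_weight q (weight u) (weight_walks a q n)) //.
by apply: eq_big => // v _; apply: IHn.
Qed.

(** * Walk counts as matrix powers *)

Lemma Amx_exp_ones (a q n : nat) (i : 'I_#|states a q|) :
  (Amx a q ^+ n *m ones #|states a q|) i ord0 =
  (walks (@fits a q) n (enum_val i))%:R.
Proof.
elim: n i => [|n IHn] i; first by rewrite expr0 mul1mx mxE.
rewrite exprS -mulmxE -mulmxA mxE /= natr_sum.
(* A neighbour has weight at most [q], so the sum over all vectors already runs inside the index set
   of [Amx]. *)
rewrite (eq_bigl (fun v => (v \in states a q) && fits (enum_val i) v)); last first.
  move=> v; rewrite inE /fits; case: leqP; rewrite ?andbT ?andbF // => uv.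
  by rewrite (leq_trans (leq_addl _ _) uv).
rewrite big_enum_val_cond [RHS]big_mkcond /=; apply: eq_bigr => j _.
by rewrite IHn mxE /fits; case: ifP => _; rewrite ?mul1r ?mul0r.
Qed.

Lemma Cmx_exp_ones (a q n : nat) (r : 'I_q.+1) :
  (Cmx a q ^+ n *m ones q.+1) r ord0 = (weight_walks a q n r)%:R.
Proof.
elim: n r => [|n IHn] r; first by rewrite expr0 mul1mx mxE.
rewrite exprS -mulmxE -mulmxA mxE /= natr_sum [RHS]big_mkcond.
apply: eq_bigr => s _.
by rewrite IHn mxE; case: ifP => _; rewrite ?mul0r // natrM.
Qed.

Lemma Amx_count (a q n : nat) :
  scalar_of ((ones #|states a q|)^T *m Amx a q ^+ n *m ones #|states a q|) =
  #|@admissible a q n|%:Z.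
Proof.
rewrite card_admissible -mulmxA /scalar_of mxE -natz natr_sum [RHS]big_enum_val.
by apply: eq_bigr => i _; rewrite Amx_exp_ones !mxE mul1r.
Qed.

Lemma Cmx_count (a q n : nat) : (0 < a)%N ->
  scalar_of (mu a q *m Cmx a q ^+ n *m ones q.+1) = #|@admissible a q n|%:Z.
Proof.
move=> a_gt0; rewrite card_admissible -mulmxA /scalar_of mxE -natz.
under [in RHS]eq_bigr => u _ do rewrite walks_weight //.
(* The starting state is treated as a neighbour of weight 0; lumping then produces the row [mu]. *)
rewrite (eq_bigl (fun u => 0 + weight u <= q)%N); last by move=> u; rewrite inE.
rewrite sum_weight // natr_sum [RHS]big_mkcond; apply: eq_bigr => s _.
by rewrite Cmx_exp_ones mxE add0n -ltnS ltn_ord natrM.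
Qed.

(** * Lattice points of the dilated polytope *)

Section LatticePoints.
Variable R : realType.
Implicit Types (a q m n : nat).

Lemma row_totalZ m a (c : R) (x : 'M[R]_(m, a)) (i : 'I_m) :
  row_total (c *: x) i = c * row_total x i.
Proof. by rewrite /row_total mulr_sumr; apply: eq_bigr => j _; rewrite mxE. Qed.

Lemma entry_le_row_total m a (x : 'M[R]_(m, a)) (i : 'I_m) (j : 'I_a) :
  (forall i j, 0 <= x i j) -> x i j <= row_total x i.
Proof. by move=> x0; rewrite /row_total (bigD1 j) //= lerDl sumr_ge0. Qed.

Lemma row_total_ge0 m a (x : 'M[R]_(m, a)) (i : 'I_m) :
  (forall i j, 0 <= x i j) -> 0 <= row_total x i.
Proof. by move=> x0; rewrite /row_total sumr_ge0. Qed.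

(** The inequalities of [path_block_polytope] are the case [c = 1]; a free right-hand side lets them
    follow a dilation. *)
Definition row_bounds m a (c : R) (x : 'M[R]_(m, a)) :=
  if m == 1%N then forall i : 'I_m, row_total x i <= c
  else forall i i' : 'I_m, i' = i.+1 :> nat -> row_total x i + row_total x i' <= c.

(** With at least two rows, each row has a neighbour, whose total is nonnegative: the next row for
    the first one, the previous row for the others. *)
Lemma row_bounds_row_total_le n a (c : R) (x : 'M[R]_(n.+1, a)) (i : 'I_n.+1) :
  (forall i j, 0 <= x i j) -> row_bounds c x -> row_total x i <= c.
Proof.
move=> x0; case: n x i x0 => [|n] x i x0; rewrite /row_bounds /=; first exact.
have tot0 k := row_total_ge0 k x0.
move=> xc; have [i0|i_gt0] := posnP i.
  have /xc : (inord 1 : 'I_n.+2) = i.+1 :> nat by rewrite i0 inordK.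
  by apply: le_trans; rewrite lerDl.
have /xc : i = (inord i.-1 : 'I_n.+2).+1 :> nat.
  by rewrite inordK prednK // ltnW.
by apply: le_trans; rewrite lerDr.
Qed.

Lemma row_boundsZ m a (c d : R) (x : 'M[R]_(m, a)) : 0 <= d ->
  row_bounds c x -> row_bounds (d * c) (d *: x).
Proof.
rewrite /row_bounds => d0; case: ifP => _ xc i => [|i' ii'].
  by rewrite row_totalZ ler_wpM2l.
by rewrite !row_totalZ -mulrDr ler_wpM2l // xc.
Qed.

Lemma dilate_path_block_polytopeP n a q (x : 'M[R]_(n.+1, a)) :
  dilate q%:R (path_block_polytope (R := R) (m := n.+1) (a := a)) x <->
  (forall i j, 0 <= x i j) /\ row_bounds q%:R x.
Proof.
split=> [[y [y0 yb] <-]|[x0 xb]].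
  split=> [i j|]; first by rewrite mxE mulr_ge0.
  by have := row_boundsZ (ler0n R q) yb; rewrite mulr1.
(* For [q = 0] one cannot divide by [q]; the bounds force [x = 0], the image of the origin. *)
have [q0|q_gt0] := posnP q.
  exists 0.
    have tot0 (i : 'I_n.+1) : row_total (0 : 'M[R]_(n.+1, a)) i = 0.
      by rewrite /row_total big1 // => j _; rewrite mxE.
    split=> [i j|]; first by rewrite mxE.
    by case: ifP => _ i => [|i' _]; rewrite !tot0 ?addr0 ler01.
  rewrite scaler0; apply/matrixP => i j; rewrite mxE; apply/eqP.
  rewrite eq_le x0 (le_trans (entry_le_row_total _ _ x0)) //.
  by rewrite -[0]/(0%:R) -q0 row_bounds_row_total_le.
have q_neq0 : q%:R != 0 :> R by rewrite pnatr_eq0 -lt0n.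
exists (q%:R^-1 *: x); last by rewrite scalerA divff // scale1r.
split=> [i j|]; first by rewrite mxE mulr_ge0 ?invr_ge0.
by have := row_boundsZ (_ : 0 <= q%:R^-1) xb; rewrite invr_ge0 mulVf //; apply.
Qed.

Definition matrix_of_states a q m (t : m.-tuple (a.-tuple 'I_q.+1)) :
  'M[R]_(m, a) := \matrix_(i, j) (tnth (tnth t i) j)%:R.

Lemma matrix_of_states_inj a q m : injective (@matrix_of_states a q m).
Proof.
move=> t1 t2 /matrixP tt; apply: eq_from_tnth => i; apply: eq_from_tnth => j.
by apply/val_inj/eqP; have /eqP := tt i j; rewrite !mxE eqr_nat.
Qed.

Lemma row_total_matrix_of_states a q m (t : m.-tuple (a.-tuple 'I_q.+1)) i :
  row_total (matrix_of_states t) i = (weight (tnth t i))%:R.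
Proof.
by rewrite weightE natr_sum; apply: eq_bigr => j _; rewrite mxE.
Qed.

Lemma row_bounds_matrix_of_states a q n (t : n.+1.-tuple (a.-tuple 'I_q.+1)) :
  row_bounds q%:R (matrix_of_states t) <-> admissible t.
Proof.
rewrite /admissible; case: n t => [|n] t; rewrite /row_bounds /=.
  (* A single state is trivially sorted, so only the head bound remains, as in the one-row
     polytope. *)
  rewrite (_ : sorted _ _); last first.
    by rewrite (tuple_eta t) /= [behead _]size0nil // size_tuple.
  rewrite andbT; split=> [/(_ ord0)|wt i]; rewrite row_total_matrix_of_states ler_nat //.
  by rewrite (ord1 i).
have -> : (weight (thead t) <= q)%N && sorted (@fits a q) t = sorted (@fits a q) t.
  apply: andb_idl => /(sortedP (thead t))/(_ 0%N); rewrite size_tuple => /(_ isT).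
  by rewrite -[nth _ t 0](tnth_nth _ t ord0); apply: leq_trans; rewrite leq_addr.
have fitsE (i i' : 'I_n.+2) :
    (row_total (matrix_of_states t) i + row_total (matrix_of_states t) i' <= q%:R)
    = fits (tnth t i) (tnth t i').
  by rewrite !row_total_matrix_of_states -natrD ler_nat.
split=> [tb|/(sortedP (thead t)) ts i i' ii'].
  apply/(sortedP (thead t)) => i; rewrite size_tuple => i_lt.
  have := tb (Ordinal (ltnW i_lt)) (Ordinal i_lt) erefl.
  by rewrite fitsE !(tnth_nth (thead t)).
rewrite fitsE !(tnth_nth (thead t)) ii'; apply: ts.
by rewrite size_tuple -ii'.
Qed.

Lemma lattice_pointsE a q n :
  (dilate q%:R (path_block_polytope (R := R) (m := n.+1) (a := a))
     `&` lattice (R := R) (m := n.+1) (a := a) =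
   [set matrix_of_states t | t in [set` @admissible a q n]])%classic.
Proof.
apply/seteqP; split=> [x [/dilate_path_block_polytopeP[x0 xb] xZ]|_ [t tP <-]].
  (* Entries are nonnegative integers, so truncation is exact; they are at most [q] because their
     row total is, so [inord] is exact too. *)
  pose t := [tuple [tuple inord (Num.truncn (x i j)) | j < a] | i < n.+1]
    : n.+1.-tuple (a.-tuple 'I_q.+1).
  have tE : matrix_of_states t = x.
    apply/matrixP => i j; rewrite mxE !tnth_mktuple.
    have xN : x i j \is a Num.nat by rewrite natrEint xZ x0.
    rewrite inordK ?truncnK // ltnS -(ler_nat R) truncnK //.
    rewrite (le_trans (entry_le_row_total _ _ x0)) //.
    exact: row_bounds_row_total_le.
  by exists t => //; apply/row_bounds_matrix_of_states; rewrite tE.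
split; last by move=> i j; rewrite mxE natr_int.
apply/dilate_path_block_polytopeP; split; last exact/row_bounds_matrix_of_states.
by move=> i j; rewrite mxE.
Qed.

Lemma lattice_count_admissible a q n :
  lattice_count R a n.+1 q = #|@admissible a q n|.
Proof.
(* As the image of a finite set, the set counted escapes the default value of [fset_set]. *)
rewrite /lattice_count lattice_pointsE fset_set_image; last exact: finite_finset.
rewrite card_imfset; last exact: matrix_of_states_inj.
rewrite cardE; apply/perm_size/uniq_perm; rewrite ?enum_uniq ?fset_uniq //.
move=> t; rewrite mem_enum.
by rewrite in_fset_set ?mem_setE //; exact: finite_finset.
Qed.

End LatticePoints.

(** * Formal power series and the resolvent of a matrix *)

Section Resolvent.
Variable K : comNzRingType.

Lemma fps_coef_sum (I : Type) (s : seq I) (P : pred I) (F : I -> fps K) n :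
  fps_coef (\sum_(i <- s | P i) F i) n = \sum_(i <- s | P i) fps_coef (F i) n.
Proof.
(* The zero series is [fpsC 0], whose coefficients are a conditional with both branches 0. *)
by apply: (big_morph (fun f => fps_coef f n)) => //=; case: (n == 0)%N.
Qed.

Lemma fps_coefCM (c : K) (f : fps K) n : fps_coef (fpsC c * f) n = c * fps_coef f n.
Proof.
rewrite /= big_ord_recl subn0 /= big1 ?addr0 // => i _.
by rewrite mul0r.
Qed.

Lemma fps_coefXM (f : fps K) n :
  fps_coef (fpsX * f) n = if n is n'.+1 then fps_coef f n' else 0.
Proof.
rewrite /=; case: n => [|n]; first by rewrite big_ord_recl big_ord0 mul0r addr0.
rewrite !big_ord_recl /= mul0r add0r mul1r subSS subn0.
by rewrite big1 ?addr0 // => i _; rewrite mul0r.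
Qed.

End Resolvent.

(** The geometric series $\sum_n y^n M^n$, stored entrywise. *)
Definition power_series_mx (k : nat) (M : 'M[int]_k) : 'M[fps int]_k :=
  \matrix_(i, j) Fps (fun n => (M ^+ n) i j).

(** The entries of [fps_mx M] are constant series, so multiplying by it acts on each degree
    separately. *)
Lemma fps_coef_mulmx (k l m n : nat) (M : 'M[int]_(k, l)) (B : 'M[fps int]_(l, m))
    i j :
  fps_coef ((fps_mx M *m B) i j) n = (M *m map_mx (fun f => fps_coef f n) B) i j.
Proof.
rewrite !mxE fps_coef_sum; apply: eq_bigr => s _.
by rewrite !mxE fps_coefCM.
Qed.

(** The product telescopes: degree 0 gives the identity, and degree [n.+1] gives
    [M ^+ n.+1 - M * M ^+ n = 0]. *)
Lemma power_series_mx_mulVmx (k : nat) (M : 'M[int]_k) :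
  (1%:M - fpsX *: fps_mx M) *m power_series_mx M = 1%:M.
Proof.
have coefP n : map_mx (fun f => fps_coef f n) (power_series_mx M) = M ^+ n.
  by apply/matrixP => i j; rewrite !mxE.
have coefB (P Q : 'M[fps int]_k) i j n : fps_coef ((P - fpsX *: Q) i j) n =
    fps_coef (P i j) n - fps_coef (fpsX * Q i j) n by rewrite !mxE.
rewrite mulmxBl mul1mx -scalemxAl; apply/matrixP => i j; apply/fpsP => n.
rewrite coefB fps_coefXM mxE; case: n => [|n].
  by rewrite subr0 /= !mxE; case: (i == j).
rewrite fps_coef_mulmx coefP mulmxE -exprS subrr !mxE.
by case: (i == j).
Qed.

Theorem theorem1p1 (R : realType) (a q : nat) (a_gt0 : (0 < a)%N) :
  [/\ forall m : nat, (0 < m)%N ->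
        (lattice_count R a m q)%:Z =
          scalar_of ((ones #|states a q|)^T *m Amx a q ^+ m.-1
                     *m ones #|states a q|) /\
        scalar_of ((ones #|states a q|)^T *m Amx a q ^+ m.-1
                   *m ones #|states a q|) =
          scalar_of (mu a q *m Cmx a q ^+ m.-1 *m ones q.+1),
      forall n : nat,
        scalar_of ((ones #|states a q|)^T *m Amx a q ^+ n
                   *m ones #|states a q|) =
          scalar_of (mu a q *m Cmx a q ^+ n *m ones q.+1),
      1%:M - fpsX *: fps_mx (Cmx a q) \in unitmx &
      count_series R a q =
        scalar_of (fps_mx (mu a q)
                   *m invmx (1%:M - fpsX *: fps_mx (Cmx a q))
                   *m ones q.+1)].
Proof.
(* Over a commutative ring, a one-sided inverse of a square matrix makes it invertible. *)
have [unitC _] := mulmx1_unit (power_series_mx_mulVmx (Cmx a q)).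
have invC : invmx (1%:M - fpsX *: fps_mx (Cmx a q)) = power_series_mx (Cmx a q).
  by rewrite -[RHS](mulKmx unitC) power_series_mx_mulVmx mulmx1.
split=> // [[//|n] _|n|].
- by rewrite /= Amx_count Cmx_count // lattice_count_admissible.
- by rewrite Amx_count Cmx_count.
apply/fpsP => n; rewrite [LHS]/= lattice_count_admissible -Cmx_count // invC.
(* As [mu] is constant, taking the coefficient of degree [n] passes to the geometric series and
   selects [Cmx a q ^+ n]. *)
rewrite /scalar_of -!mulmxA fps_coef_mulmx; congr ((_ *m _) _ _).
apply/matrixP => i j; rewrite [RHS]mxE !mxE fps_coef_sum.
apply: eq_bigr => s _; rewrite !mxE mulr1.
by rewrite -[1]/(fpsC 1) mulrC fps_coefCM mul1r.
Qed.
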